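(* Let $D$ be any digraph without symmetric arcs (no pair of arcs $uv,vu$). Then $\gamma_{os}(D)\le\gamma^+(D)+\gamma^-(D)$.
   Context: Digraphs $D=(V,A)$ are finite, without loops or multiple arcs. The underlying graph $G$ of $D$ has vertex set $V$, with $u,v$ adjacent iff $uv\in A$ or $vu\in A$. $S\subseteq V$ is out-dominating if every $v\in V\setminus S$ has an in-neighbor in $S$, and in-dominating if every $v\in V\setminus S$ has an out-neighbor in $S$; $\gamma^+(D)$ and $\gamma^-(D)$ are the minimum sizes of such sets. $S$ is dominating in $G$ if every vertex outside $S$ has a neighbor in $S$. $S$ is an out-secure dominating set (OSDS) of $D$ if $S$ is dominating in $G$ and for every $v\in V\setminus S$ there is an in-neighbor $u\in S$ of $v$ such that $(S\setminus\{u\})\cup\{v\}$ is dominating in $G$; $\gamma_{os}(D)$ is the minimum size of an OSDS. *)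

(* Defs.v *)
From mathcomp Require Import all_boot.

Set Implicit Arguments.
Unset Strict Implicit.
Unset Printing Implicit Defensive.

(* A digraph is a finite vertex type T with an arc relation, where [arc u v]
   means that uv is an arc from u to v.  A relation has no multiple arcs; the
   absence of loops is the hypothesis [irreflexive arc]. *)

Definition no_symmetric_arcs (T : finType) (arc : rel T) : Prop :=
  forall u v : T, ~~ (arc u v && arc v u).

Definition underlying (T : finType) (arc : rel T) : rel T :=
  fun u v => arc u v || arc v u.

Definition dominating (T : finType) (adj : rel T) (S : {set T}) : bool :=
  [forall (v | v \notin S), exists u in S, adj u v].

Definition out_dominating (T : finType) (arc : rel T) (S : {set T}) : bool :=
  [forall (v | v \notin S), exists u in S, arc u v].

Definition in_dominating (T : finType) (arc : rel T) (S : {set T}) : bool :=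
  [forall (v | v \notin S), exists u in S, arc v u].

Definition osds (T : finType) (arc : rel T) (S : {set T}) : bool :=
  dominating (underlying arc) S &&
  [forall (v | v \notin S), exists u in S,
     arc u v && dominating (underlying arc) (v |: (S :\ u))].

(* The whole vertex set [set: T] has each of the three properties, see the
   lemmas below, so [arg min] selects a set of minimum size. *)

Definition gamma_out (T : finType) (arc : rel T) : nat :=
  #|[arg min_(S < [set: T] | out_dominating arc S) #|S|]|.

Definition gamma_in (T : finType) (arc : rel T) : nat :=
  #|[arg min_(S < [set: T] | in_dominating arc S) #|S|]|.

Definition gamma_os (T : finType) (arc : rel T) : nat :=
  #|[arg min_(S < [set: T] | osds arc S) #|S|]|.

Lemma out_dominatingT (T : finType) (arc : rel T) :
  out_dominating arc [set: T].
Proof. by apply/forall_inP => v; rewrite inE. Qed.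

Lemma in_dominatingT (T : finType) (arc : rel T) : in_dominating arc [set: T].
Proof. by apply/forall_inP => v; rewrite inE. Qed.

Lemma osdsT (T : finType) (arc : rel T) : osds arc [set: T].
Proof. by apply/andP; split; apply/forall_inP => v; rewrite inE. Qed.

(* Main.v *)
(* If O is out-dominating and I is in-dominating, then O :|: I is an OSDS: a
   vertex outside it has an in-neighbor in O and an out-neighbor in I, which are
   distinct because there are no symmetric arcs, so deleting a single vertex u
   leaves it dominated; u itself is dominated by the vertex that replaces it. *)
Require Import Defs.
From mathcomp Require Import all_boot.

Lemma osdsU (T : finType) (arc : rel T) (O I : {set T}) :
  no_symmetric_arcs arc -> out_dominating arc O -> in_dominating arc I ->
  osds arc (O :|: I).
Proof.
move=> oriented /forall_inP domO /forall_inP domI.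
have in_nbr v : v \notin O :|: I -> exists2 x, x \in O & arc x v.
  by rewrite inE negb_or => /andP[/domO/exists_inP].
have out_nbr v : v \notin O :|: I -> exists2 y, y \in I & arc v y.
  by rewrite inE negb_or => /andP[_ /domI/exists_inP].
apply/andP; split; apply/forall_inP => v vS.
  have [x xO xv] := in_nbr v vS.
  by apply/exists_inP; exists x; rewrite ?inE ?xO // /underlying xv.
have [u uO uv] := in_nbr v vS.
apply/exists_inP; exists u; first by rewrite inE uO.
rewrite uv /=; apply/forall_inP => w.
rewrite in_setU1 in_setD1 negb_or negb_and negbK => /andP[_].
(* Outside the swapped set, [w] is either the removed vertex [u], which is adjacent to the new
   vertex [v] through the arc [uv], or a vertex outside [O :|: I]. *)
case: eqP => [-> _ | _ /= wS].
  by apply/exists_inP; exists v; rewrite ?inE ?eqxx // /underlying uv orbT.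
have [x xO xw] := in_nbr w wS; have [y yI wy] := out_nbr w wS.
(* The in-neighbor [x] of [w] is lost only if it is [u]. In that case [y] survives the swap, since
   [y = u] would make both [uw] and [wu] arcs. *)
have [xu | xNu] := eqVneq x u.
  have yNu : y != u.
    by apply: contraNneq (oriented w y) => yu; rewrite wy {1}yu -xu xw.
  by apply/exists_inP; exists y; rewrite ?inE ?yNu ?yI ?orbT // /underlying wy orbT.
by apply/exists_inP; exists x; rewrite ?inE ?xNu ?xO ?orbT // /underlying xw.
Qed.

Theorem theorem3p7 (T : finType) (arc : rel T) (loopless : irreflexive arc)
    (oriented : no_symmetric_arcs arc) :
  gamma_os arc <= gamma_out arc + gamma_in arc.
Proof.
rewrite /gamma_os /gamma_out /gamma_in.
case: arg_minnP => [|S _ minS]; first exact: osdsT.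
case: arg_minnP => [|O domO _]; first exact: out_dominatingT.
case: arg_minnP => [|I domI _]; first exact: in_dominatingT.
by apply: leq_trans (minS _ (osdsU _ _ _ _ oriented domO domI)) (leq_card_setU O I).
Qed.
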